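(* Let $m>1$ and $q\ge\dfrac{2m}{m-1}$. Let $f:\Omega\to\mathbb R$ be a source for which $$\liminf_{d(x)\searrow0}f(x)\,d(x)^q=\ell_d>0 .$$ Then any nonnegative supersolution $v$ of $$-\operatorname{trace}\mathcal A(\cdot)D^2v+v^m=f\quad\text{in }\Omega$$ is a large supersolution.
   Context: $\Omega\subset\mathbb R^N$, $N>1$, is a bounded open set with boundary regular enough ($\partial\Omega\in C^1$) that, with $d(x)=\operatorname{dist}(x,\partial\Omega)$ and $\Omega_\delta=\{x\in\Omega:d(x)<\delta\}$, there is $\delta_\Omega>0$ with $d\in C^1(\Omega_{\delta_\Omega})$ (there $|Dd|=1$); $\mathbf n(x)=-Dd(x)$ for $x\in\Omega_{\delta_\Omega}$. $\mathcal S^N$ is the set of real symmetric $N\times N$ matrices and $\mathcal S^N_+$ those with nonnegative eigenvalues. Standing assumptions on the coefficients: $\mathcal A:\Omega\to\mathcal S^N_+\setminus\{0\}$ is Lipschitz continuous and there are constants $0<\lambda\le\Lambda$ with $0\le\operatorname{trace}(\mathcal A(x)\,\xi\otimes\xi)\le\Lambda$ for $x\in\Omega$, $|\xi|=1$, and $\lambda\le\operatorname{trace}(\mathcal A(x)\,\mathbf n(x)\otimes\mathbf n(x))$ for $x\in\Omega_{\delta_\Omega}$, where $\operatorname{trace}(\mathcal A\,\xi\otimes\xi)=\langle\mathcal A\xi,\xi\rangle$. Supersolutions are in the viscosity sense: $v_*(x)=\liminf_{y\to x}v(y)$ is the lower semicontinuous envelope, and a function $v$ locally bounded from below is a supersolution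 if $-\operatorname{trace}(\mathcal A(x)X)+(v_*(x))^m\ge f(x)$ for all $x\in\Omega$ and all $(p,X)\in\mathbb R^N\times\mathcal S^N$ with $v_*(y)\ge v_*(x)+\langle p,y-x\rangle+\frac12\langle X(y-x),y-x\rangle+o(|y-x|^2)$ as $y\to x$. A supersolution is ''large'' if it blows up on the boundary: $v_*(x)\to+\infty$ as $d(x)\to0$. *)

(* Defs.v *)
From HB Require Import structures.
From mathcomp Require Import all_boot all_order all_algebra.
From mathcomp Require Import all_classical all_reals all_analysis.

Set Implicit Arguments.
Unset Strict Implicit.
Unset Printing Implicit Defensive.

Import Order.TTheory GRing.Theory Num.Theory.
Import numFieldNormedType.Exports.

Local Open Scope classical_set_scope.
Local Open Scope ring_scope.

(* Points of R^N are row vectors ['rV[R]_N]. The norm that the library puts on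
   matrices is the sup norm, so the Euclidean structure is defined here; the
   topology (open sets, closure, continuity) is the same for both norms. *)
Section Euclidean.
Context {R : realType} {N : nat}.
Implicit Types (x y : 'rV[R]_N) (S : set 'rV[R]_N) (u : 'rV[R]_N -> R).

Definition dotv x y : R := (x *m y^T) 0 0.

Definition enorm x : R := Num.sqrt (dotv x x).

Definition tensor x y : 'M[R]_N := x^T *m y.

Definition boundary S : set 'rV[R]_N := closure S `\` interior S.

Definition bdist S x : R := inf [set enorm (x - y) | y in boundary S].

Definition strip S (e : R) : set 'rV[R]_N := [set x | S x /\ bdist S x < e].

(* The filter "x in S, bdist S x -> 0". *)
Definition near_boundary S : set_system 'rV[R]_N :=
  filter_from [set e : R | 0 < e] (strip S).

Definition grad u x : 'rV[R]_N := \row_j 'D_(delta_mx 0 j) u x.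

(* Meant for open S. *)
Definition C1_on S u : Prop :=
  (forall x, S x -> differentiable u x) /\
  (forall x, S x -> {for x, continuous (grad u)}).

(* Positive semidefiniteness in terms of the (real) spectrum. *)
Definition psdmx (M : 'M[R]_N) : Prop :=
  M \is symmetricmx /\ (forall a : R, eigenvalue M a -> 0 <= a).

End Euclidean.

Section C1Boundary.
Context {R : realType} {N : nat}.

(* Near each boundary point, S lies strictly on one side of the graph of a C^1
   function g of N - 1 of the coordinates: up to relabelling the coordinates
   (choice of i) and reorienting them (choice of the sign s), S is the set
   {x_i > g(x_1, .., x_(i-1), x_(i+1), .., x_N)}. *)
Definition C1_boundary (S : set 'rV[R]_N) : Prop :=
  forall x0, boundary S x0 ->
  exists (i : 'I_N) (s : bool) (g : 'rV[R]_N.-1 -> R),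
    C1_on setT g /\
    \forall x \near x0, S x <-> g (col' i x) < (-1) ^+ s * x 0 i.

End C1Boundary.

Section Viscosity.
Context {R : realType} {N : nat}.
Implicit Types (S : set 'rV[R]_N) (u v f : 'rV[R]_N -> R).

(* Lower semicontinuous envelope: liminf of v(y) as y -> x, where y ranges over
   S and y = x is allowed. The values of v outside S play no role. *)
Definition lsc_envE S v (x : 'rV[R]_N) : \bar R :=
  limf_einf (fun y => (v y)%:E) (within S (nbhs x)).

(* If v is locally bounded from below in S then lsc_envE S v x is a real number
   for each x in S, so that fine loses nothing there. *)
Definition lsc_env S v (x : 'rV[R]_N) : R := fine (lsc_envE S v x).

(* (p, X) belongs to the second order subjet of u at x. *)
Definition subjet S u (x p : 'rV[R]_N) (X : 'M[R]_N) : Prop :=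
  exists2 r : 'rV[R]_N -> R,
    r =o_x (fun y => enorm (y - x) ^+ 2) &
    \forall y \near x, S y ->
      u x + dotv p (y - x) + 2^-1 * dotv ((y - x) *m X) (y - x) + r y <= u y.

Definition locally_bounded_below S v : Prop :=
  forall x, S x -> exists c : R, \forall y \near x, S y -> c <= v y.

(* Viscosity supersolutions of - trace (A(x) D^2 v) + v ^ m = f in S. The real
   power `^ is the intended one only for nonnegative base, i.e. for v >= 0. *)
Definition supersolution S (A : 'rV[R]_N -> 'M[R]_N) (m : R) f v : Prop :=
  locally_bounded_below S v /\
  forall (x p : 'rV[R]_N) (X : 'M[R]_N), S x -> X \is symmetricmx ->
    subjet S (lsc_env S v) x p X ->
    f x <= - \tr (A x *m X) + lsc_env S v x `^ m.

Definition large_supersolution S (A : 'rV[R]_N -> 'M[R]_N) (m : R) f v : Prop :=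
  supersolution S A m f v /\
  lsc_envE S v x @[x --> near_boundary S] --> +oo%E.

End Viscosity.

(* Main.v *)
Require Import Defs.
From HB Require Import structures.
From mathcomp Require Import all_boot all_order all_algebra.
From mathcomp Require Import all_classical all_reals all_analysis.
From mathcomp Require Import ring lra.

Set Implicit Arguments.
Unset Strict Implicit.
Unset Printing Implicit Defensive.

Import Order.TTheory GRing.Theory Num.Theory.
Import numFieldNormedType.Exports.

Local Open Scope classical_set_scope.
Local Open Scope ring_scope.

(** Near the boundary [f >= c d^-q] for some [c > 0], where [d] is the distance
    to the boundary, and [q > 2] because [2 m / (m - 1) > 2]. Such a source is
    too singular to be balanced by a supersolution that stays bounded: bending
    [v_*] on the scale of [d] costs only [O(d^-2)].

    In detail, suppose that [v_* x < M] at a point [x] at distance [d] from the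
    boundary. The closed Euclidean ball of radius [r = d / 2] around [x] lies in
    [Omega] ([eball_subset]). Since [v_* >= 0], the function
    [v_* + (M / r^2) |. - x|^2] is less than [M] at [x] and at least [M] off the
    interior of the ball; being lower semicontinuous, it has a minimum point [y]
    ([lsc_compact_attains_min]), where a paraboloid with Hessian
    [- (2 M / r^2) I] touches [v_*] from below. As the trace of [A y] is at most
    [N Lambda], the equation gives [f y <= 2 (M / r^2) N Lambda + M^m]
    ([supersolution_eball]). On the other hand [y] is at distance at most [2 d]
    from the boundary, so [f y >= c (2 d)^-q]. As [q > 2], the two bounds are
    incompatible once [d] is small in terms of [M] ([powR_absorb]), so
    [v_* >= M] in a whole strip along the boundary. *)

(** * Euclidean geometry of row vectors *)

Section EuclideanGeometry.
Context {R : realType} {N : nat}.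
Implicit Types x y z : 'rV[R]_N.

Lemma dotvE x y : dotv x y = \sum_i x 0 i * y 0 i.
Proof. by rewrite /dotv mxE; apply: eq_bigr => i _; rewrite mxE. Qed.

Lemma dotvC x y : dotv x y = dotv y x.
Proof. by rewrite !dotvE; apply: eq_bigr => i _; rewrite mulrC. Qed.

Lemma dotvDl x y z : dotv (x + y) z = dotv x z + dotv y z.
Proof. by rewrite /dotv mulmxDl mxE. Qed.

Lemma dotvZl a x y : dotv (a *: x) y = a * dotv x y.
Proof. by rewrite /dotv -scalemxAl mxE. Qed.

Lemma dotvDr x y z : dotv x (y + z) = dotv x y + dotv x z.
Proof. by rewrite dotvC dotvDl !(dotvC x). Qed.

Lemma dotvZr a x y : dotv x (a *: y) = a * dotv x y.
Proof. by rewrite dotvC dotvZl dotvC. Qed.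

Lemma dotvv_ge0 x : 0 <= dotv x x.
Proof. by rewrite dotvE; apply: sumr_ge0 => i _; rewrite -expr2 sqr_ge0. Qed.

Lemma sqr_coord_le_dotvv x i : x 0 i ^+ 2 <= dotv x x.
Proof.
rewrite dotvE (bigD1 i) //= expr2 lerDl.
by apply: sumr_ge0 => j _; rewrite -expr2 sqr_ge0.
Qed.

Lemma dotvv_eq0 x : dotv x x = 0 -> x = 0.
Proof.
move=> x0; apply/rowP => i; rewrite mxE; apply/eqP.
by rewrite -sqrf_eq0 -[_ == 0]andbT eq_le sqr_ge0 -x0 sqr_coord_le_dotvv.
Qed.

Lemma enorm_ge0 x : 0 <= enorm x.
Proof. exact: sqrtr_ge0. Qed.

Lemma sqr_enorm x : enorm x ^+ 2 = dotv x x.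
Proof. by rewrite sqr_sqrtr ?dotvv_ge0. Qed.

Lemma enormN x : enorm (- x) = enorm x.
Proof. by rewrite /enorm -scaleN1r dotvZl dotvZr !mulN1r opprK. Qed.

Lemma enormZ a x : enorm (a *: x) = `|a| * enorm x.
Proof.
by rewrite /enorm dotvZl dotvZr mulrA -expr2 sqrtrM ?sqr_ge0 // sqrtr_sqr.
Qed.

Lemma Cauchy_Schwarz x y : dotv x y ^+ 2 <= dotv x x * dotv y y.
Proof.
have [y0|y0] := eqVneq (dotv y y) 0.
  by rewrite (dotvv_eq0 y0) -(scale0r x) !dotvZr !mul0r expr2 !mulr0.
have y_gt0 : 0 < dotv y y by rewrite lt_def y0 dotvv_ge0.
(* The vector below is [dotv y y] times the component of [x] orthogonal to
   [y]. *)
have := dotvv_ge0 (dotv y y *: x + (- dotv x y) *: y).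
rewrite !(dotvDl, dotvDr, dotvZl, dotvZr) (dotvC y x) => h.
rewrite -subr_ge0 -(pmulr_rge0 _ y_gt0).
apply: (le_trans h); rewrite le_eqVlt; apply/orP; left; apply/eqP; ring.
Qed.

Lemma enormD x y : enorm (x + y) <= enorm x + enorm y.
Proof.
rewrite -(ler_pXn2r (n := 2)) ?nnegrE ?addr_ge0 ?enorm_ge0 //.
rewrite sqr_enorm sqrrD !sqr_enorm !(dotvDl, dotvDr) (dotvC y x).
have : dotv x y <= enorm x * enorm y.
  apply: (le_trans (ler_norm _)).
  rewrite -(ler_pXn2r (n := 2)) ?nnegrE ?mulr_ge0 ?enorm_ge0 //.
  by rewrite real_normK ?num_real // exprMn !sqr_enorm Cauchy_Schwarz.
by move=> ?; lra.
Qed.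

Lemma dotvv_sub_continuous x : continuous (fun y => dotv (y - x) (y - x)).
Proof.
rewrite (_ : (fun _ => _) = fun y => \sum_i (y 0 i - x 0 i) * (y 0 i - x 0 i)).
  apply: (continuous_big (@add_continuous R)) => i _ y.
  have yi : z 0 i - x 0 i @[z --> y] --> y 0 i - x 0 i.
    by apply: cvgB; [exact: coord_continuous|exact: cvg_cst].
  exact: (cvgM yi yi).
by apply/funext => y; rewrite dotvE; apply: eq_bigr => i _; rewrite !mxE.
Qed.

Lemma compact_eball x r : compact [set y | dotv (y - x) (y - x) <= r ^+ 2].
Proof.
apply: bounded_closed_compact; last first.
  have /continuous_closedP clf := @dotvv_sub_continuous x.
  exact: (clf _ (@closed_le R (r ^+ 2))).
exists (`|x| + `|r|); split; first exact: num_real.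
move=> M ltM y /= yr; apply/ltW/le_lt_trans/ltM.
rewrite -[y](subrK x) addrC; apply: (le_trans (ler_normD _ _)); rewrite lerD2l.
rewrite [`|y - x|]mx_normrE; apply: bigmax_le => // -[i j] _ /=.
rewrite (ord1 i) -(ler_pXn2r (n := 2)) ?nnegrE //.
rewrite !real_normK ?num_real //.
exact/(le_trans _ yr)/sqr_coord_le_dotvv.
Qed.

End EuclideanGeometry.

(** * Distance to the boundary *)

Section DistanceToBoundary.
Context {R : realType} {N : nat}.
Implicit Types (x y z : 'rV[R]_N) (S : set 'rV[R]_N).

Lemma bdist_le_enorm S x z : boundary S z -> bdist S x <= enorm (x - z).
Proof.
move=> Sz; apply: ge_inf; last by exists z.
by exists 0 => _ [y _ <-]; exact: enorm_ge0.
Qed.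

Lemma bdist_ge0 S x : 0 <= bdist S x.
Proof.
rewrite /bdist.
have [->|/set0P B0] := eqVneq [set enorm (x - y) | y in boundary S] set0.
  by rewrite inf0.
by apply: lb_le_inf => // _ [y _ <-]; exact: enorm_ge0.
Qed.

(** A positive value of [bdist] forces the boundary to be nonempty, because the
    infimum of the empty set is [0] by convention. *)
Lemma boundary_neq0 S x : 0 < bdist S x -> boundary S !=set0.
Proof.
move=> x0; apply/set0P/eqP => S0.
by move: x0; rewrite /bdist S0 image_set0 inf0 ltxx.
Qed.

Lemma bdist_lipschitz S x y :
  boundary S !=set0 -> bdist S y <= bdist S x + enorm (y - x).
Proof.
move=> [z0 Sz0]; rewrite -lerBlDr; apply: lb_le_inf.
  by exists (enorm (x - z0)); exists z0.
move=> _ [z Sz <-]; rewrite lerBlDl; apply: (le_trans (bdist_le_enorm _ Sz)).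
rewrite (_ : y - z = y - x + (x - z)); first exact: enormD.
by rewrite addrA [y - x + x]subrK.
Qed.

(** Otherwise interior and closure of [S] would cut the same clopen part, neither
    empty nor full, out of the connected interval [0, 1]. *)
Lemma segment_meets_boundary S x y : S x -> ~ S y ->
  exists t : R, 0 <= t <= 1 /\ boundary S (x + t *: (y - x)).
Proof.
move=> Sx nSy; pose g (t : R) := x + t *: (y - x).
have cg : continuous g.
  move=> t; apply: cvgD; first exact: cvg_cst.
  exact: (cvgZr_tmp cvg_id).
have g0 : g 0 = x by rewrite /g scale0r addr0.
have g1 : g 1 = y by rewrite /g scale1r addrC subrK.
apply: contrapT => noB.
have closure_int t : 0 <= t <= 1 -> closure S (g t) -> interior S (g t).
  by move=> t01 St; apply: contrapT => nSt; apply: noB; exists t.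
pose B := `[0, 1]%classic `&` g @^-1` (interior S).
have B01 : B = `[0, 1]%classic.
  apply: (@segment_connected R 0 1).
  - exists 0; split; first by rewrite /= in_itv /= lexx ler01.
    by apply: closure_int; rewrite ?lexx ?ler01 // g0; exact: subset_closure.
  - exists (g @^-1` (interior S)) => //.
    by move/continuousP : cg; apply; exact: open_interior.
  - exists (g @^-1` (closure S)).
      by move/continuous_closedP : cg; apply; exact: closed_closure.
    apply/seteqP; split=> t [t01 St]; split=> //.
      by apply: subset_closure; exact: interior_subset St.
    by apply: closure_int => //; move: t01; rewrite /= in_itv.
have : B 1 by rewrite B01 /= in_itv /= ler01 lexx.
by move=> [_]; rewrite /= g1 => /interior_subset.
Qed.

Lemma eball_subset S x y : S x -> enorm (y - x) < bdist S x -> S y.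
Proof.
move=> Sx yx; apply: contrapT => nSy.
have [t [/andP[t0 t1] St]] := segment_meets_boundary Sx nSy.
move: yx; rewrite ltNge => /negP; apply; apply: (le_trans (bdist_le_enorm x St)).
by rewrite opprD addNKr enormN enormZ ger0_norm // ler_piMl ?enorm_ge0.
Qed.

End DistanceToBoundary.

(** * Lower semicontinuity *)

(** The sets [{y in K | w y <= w z}], for [z] in [K], form a filter base since
    they are nested; a cluster point of it is a minimum, by semicontinuity. *)
Lemma lsc_compact_attains_min (R : realType) (T : topologicalType)
    (K : set T) (w : T -> R) :
    compact K -> K !=set0 ->
    (forall x a, K x -> a < w x -> \forall y \near x, K y -> a <= w y) ->
  exists2 x, K x & forall y, K y -> w x <= w y.
Proof.
move=> cK [z0 Kz0] lscw.
pose F := filter_from K (fun z => K `&` [set y | w y <= w z]).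
have FF : ProperFilter F.
  apply: filter_from_proper; last by move=> z Kz; exists z; split=> /=.
  apply: filter_from_filter; first by exists z0.
  move=> z1 z2 Kz1 Kz2; have [z12|/ltW z21] := leP (w z1) (w z2).
    exists z1 => // y [Ky yz]; split; split=> //=; exact: le_trans yz z12.
  exists z2 => // y [Ky yz]; split; split=> //=; exact: le_trans yz z21.
have [|x [Kx xF]] := cK F FF; first by exists z0 => // y [].
exists x => // z Kz; rewrite leNgt; apply/negP => zx.
have [y [[Ky yz] wy]] : (K `&` [set y | w y <= w z]) `&`
    [set y | K y -> (w z + w x) / 2 <= w y] !=set0.
  by apply: xF; [exists z | apply: lscw => //; lra].
by move: (wy Ky) yz => /=; lra.
Qed.

Section Envelope.
Context {R : realType} {N : nat}.
Variables (S : set 'rV[R]_N) (v : 'rV[R]_N -> R).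
Hypothesis v_ge0 : forall x, S x -> 0 <= v x.

Lemma lsc_envE_ge0 x : (0 <= lsc_envE S v x)%E.
Proof.
rewrite /lsc_envE limf_einfE.
apply: (@le_trans _ _ (ereal_inf [set (v y)%:E | y in S])).
  by apply: le_ereal_inf_tmp => _ [y Sy <-]; rewrite lee_fin v_ge0.
by apply: ereal_sup_ubound; exists S => //; exact: nearW.
Qed.

Lemma lsc_envE_le x : S x -> (lsc_envE S v x <= (v x)%:E)%E.
Proof.
move=> Sx; rewrite /lsc_envE limf_einfE; apply: ge_ereal_sup => _ [V xV <-].
by apply: ereal_inf_lbound; exists x => //; exact: (nbhs_singleton xV).
Qed.

Lemma lsc_envK x : S x -> lsc_envE S v x = (lsc_env S v x)%:E.
Proof.
move=> Sx; rewrite /lsc_env fineK // fin_numE.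
have := lsc_envE_ge0 x; have := lsc_envE_le Sx.
by case: (lsc_envE S v x).
Qed.

Lemma lsc_env_ge0 x : 0 <= lsc_env S v x.
Proof. exact/fine_ge0/lsc_envE_ge0. Qed.

Lemma lsc_env_lsc x a : S x -> a < lsc_env S v x ->
  \forall y \near x, S y -> a <= lsc_env S v y.
Proof.
move=> Sx; rewrite -lte_fin -lsc_envK // /lsc_envE limf_einfE.
move=> /ereal_sup_gt[_ [V xV <-] aV].
apply: filterS (nbhs_interior xV) => y yV Sy.
rewrite -lee_fin -lsc_envK //; apply: (le_trans (ltW aV)).
by rewrite /lsc_envE limf_einfE; apply: ereal_sup_ubound; exists V.
Qed.

End Envelope.

(** * Touching from below by a concave paraboloid *)

Section Touching.
Context {R : realType} {N : nat}.
Implicit Types (x y z : 'rV[R]_N) (S : set 'rV[R]_N).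

Lemma subjet_of_min S (u : 'rV[R]_N -> R) a x y :
    (forall z, S z -> u y + a * dotv (y - x) (y - x) <=
                      u z + a * dotv (z - x) (z - x)) ->
  subjet S u y (- (2 * a) *: (y - x)) (- (2 * a))%:M.
Proof.
move=> ymin; exists (fun=> 0).
  by apply/eqoP => e e0; apply: nearW => z; rewrite normr0 mulr_ge0 // ltW.
near=> z => Sz; move: (ymin z Sz).
rewrite (_ : z - x = (z - y) + (y - x)); last by rewrite addrA subrK.
move: (z - y) (y - x) => d e.
rewrite mul_mx_scalar !(dotvDl, dotvDr, dotvZl, dotvZr) (dotvC e d).
by move=> ?; lra.
Unshelve. all: by end_near.
Qed.

Lemma tr_mul_tensor_delta (B : 'M[R]_N) i :
  \tr (B *m tensor (delta_mx 0 i) (delta_mx 0 i)) = B i i.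
Proof.
rewrite /tensor mulmxA mxtrace_mulC mulmxA -rowE trmx_delta -colE.
by rewrite trace_mx11 !mxE.
Qed.

Lemma mxtrace_le (B : 'M[R]_N) (L : R) :
  (forall xi, enorm xi = 1 -> \tr (B *m tensor xi xi) <= L) -> \tr B <= N%:R * L.
Proof.
move=> BL; rewrite /mxtrace mulr_natl -[N in _ *+ N]card_ord -sumr_const.
apply: ler_sum => i _; rewrite -tr_mul_tensor_delta; apply: BL.
by rewrite /enorm /dotv trmx_delta mul_delta_mx mxE !eqxx sqrtr1.
Qed.

(** The penalized function [v_* + (M / r^2) |. - x|^2] is less than [M] at
    the centre of the ball and at least [M] outside it, so its minimum over the
    ball is a minimum over [S]; there the equation can be tested with
    the Hessian [- (2 M / r^2) I]. *)
Lemma supersolution_eball S (A : 'rV[R]_N -> 'M[R]_N) (m : R) f v T x r M :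
    0 <= m -> (forall y, S y -> 0 <= v y) -> supersolution S A m f v ->
    (forall y, S y -> \tr (A y) <= T) ->
    0 < r -> (forall y, enorm (y - x) <= r -> S y) ->
    lsc_env S v x < M ->
  exists2 y, enorm (y - x) <= r & f y <= 2 * (M / r ^+ 2) * T + M `^ m.
Proof.
move=> m0 v0 [_ vsup] trA r0 rS uxM; set u := lsc_env S v in uxM *.
have u0 y : 0 <= u y by exact: lsc_env_ge0.
have M0 : 0 < M by exact: le_lt_trans (u0 x) uxM.
have r20 : 0 < r ^+ 2 by rewrite exprn_gt0.
have ballE y : (dotv (y - x) (y - x) <= r ^+ 2) = (enorm (y - x) <= r).
  by rewrite -sqr_enorm ler_pXn2r ?nnegrE ?enorm_ge0 ?(ltW r0).
set a := M / r ^+ 2; have a0 : 0 < a by rewrite divr_gt0.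
pose w y := u y + a * dotv (y - x) (y - x).
have wx : w x = u x by rewrite /w subrr /dotv mul0mx mxE mulr0 addr0.
pose K := [set y | dotv (y - x) (y - x) <= r ^+ 2].
have Kx : K x by rewrite /K /= subrr /dotv mul0mx mxE ltW.
have KS y : K y -> S y by rewrite /K /= ballE => /rS.
have [||y Ky ymin] := @lsc_compact_attains_min _ _ K w (@compact_eball _ _ x r).
- by exists x.
- move=> y b Ky bw; pose e := (w y - b) / 2.
  have e0 : 0 < e by rewrite /e; lra.
  have uy : \forall z \near y, S z -> u y - e <= u z.
    apply: (lsc_env_lsc v0 (KS _ Ky)); rewrite ltrBlDr ltrDl; exact: e0.
  have cq : {for y, continuous (fun z => a * dotv (z - x) (z - x))}.
    exact: (cvgM (cvg_cst a) (@dotvv_sub_continuous _ _ x y)).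
  have qy : \forall z \near y,
      a * dotv (y - x) (y - x) - e < a * dotv (z - x) (z - x).
    by apply: (cvgr_gt _ cq); rewrite ltrBlDr ltrDl.
  near=> z => Kz.
  have uz : u y - e <= u z by apply: (near uy z) => //; exact: KS.
  have qz : a * dotv (y - x) (y - x) - e < a * dotv (z - x) (z - x).
    exact: (near qy z).
  by move: uz qz; rewrite /e /w; lra.
have wyM : w y < M by apply: le_lt_trans uxM; rewrite -wx; exact: ymin.
exists y; first by rewrite -ballE.
have uyM : u y <= M.
  by apply/ltW/(le_lt_trans _ wyM); rewrite lerDl mulr_ge0 ?dotvv_ge0 ?ltW.
(* Outside the ball the penalty alone exceeds [M]. *)
have gmin z : S z -> w y <= w z.
  move=> _; have [/ymin//|rz] := leP (dotv (z - x) (z - x)) (r ^+ 2).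
  apply: (le_trans (ltW wyM)); rewrite -[M](divfK (lt0r_neq0 r20)) -/a.
  by rewrite ler_wpDl // ler_wpM2l // ltW.
have := vsup y _ _ (KS _ Ky) _ (subjet_of_min gmin).
rewrite mul_mx_scalar mxtraceZ mulNr opprK => h.
apply: (le_trans (h _)).
  by rewrite is_hermitianmxE expr0 scale1r tr_scalar_mx map_mx_id.
apply: lerD.
  by apply: ler_wpM2l; [rewrite mulr_ge0 // ltW | exact/trA/KS].
by apply: ge0_ler_powR; rewrite ?nnegrE // ltW.
Unshelve. all: by end_near.
Qed.

End Touching.

(** * Blow-up at the boundary *)

Section NearBoundary.
Context {R : realType} {N : nat}.
Implicit Types (S : set 'rV[R]_N).

Global Instance near_boundary_filter S : Filter (near_boundary S).
Proof.
apply: filter_from_filter; first by exists 1 => /=.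
move=> a b a0 b0; exists (Num.min a b) => /=; first by rewrite lt_min a0 b0.
by move=> x [Sx]; rewrite lt_min => /andP[].
Qed.

Lemma limf_einf_near_boundary_gt0 S (g : 'rV[R]_N -> R) :
    (0 < limf_einf (fun x => (g x)%:E) (near_boundary S))%E ->
  exists c e : R, [/\ 0 < c, 0 < e & forall x, strip S e x -> c <= g x].
Proof.
rewrite limf_einfE => /ereal_sup_gt[_ [V [e /= e0 eV] <-]] V0.
have [c c0 cV] : exists2 c : R, 0 < c &
    (c%:E <= ereal_inf [set (g x)%:E | x in V])%E.
  move: V0; case: (ereal_inf _) => [r||//] r0; last by exists 1; rewrite ?leey.
  by exists r.
exists c, e; split=> // x xe; rewrite -lee_fin; apply: (le_trans cV).
by apply: ereal_inf_lbound; exists x => //; exact: eV.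
Qed.

End NearBoundary.

Lemma exponent_gt2 (R : realType) (m q : R) :
  1 < m -> 2 * m / (m - 1) <= q -> 2 < q.
Proof.
move=> m1; apply: lt_le_trans.
by rewrite ltr_pdivlMr ?subr_gt0 // ltr_pM2l // ltrBlDr ltrDl.
Qed.

(** For [s < 1] the left-hand side is at most [(K + L) s^(q - 2)], which tends
    to [0] with [s] as [q > 2]. *)
Lemma powR_absorb (R : realType) (q c K L : R) :
    2 < q -> 0 < c -> 0 <= K -> 0 < L ->
  exists2 e : R, 0 < e &
    forall s, 0 < s -> s < e -> (K / s ^+ 2 + L) * s `^ q < c.
Proof.
move=> q2 c0 K0 L0; have KL : 0 < K + L by rewrite ltr_wpDl.
have q20 : 0 < q - 2 by rewrite subr_gt0.
pose e := (c / (K + L)) `^ (q - 2)^-1.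
have e0 : 0 < e by rewrite powR_gt0 // divr_gt0.
exists (Num.min 1 e) => [|s s0]; first by rewrite lt_min ltr01 e0.
rewrite lt_min => /andP[s1 se].
have -> : s `^ q = s ^+ 2 * s `^ (q - 2).
  rewrite -powR_mulrn ?ltW // -powRD; last by rewrite (gt_eqF s0) implybT.
  by rewrite addrC subrK.
have eE : e `^ (q - 2) = c / (K + L).
  rewrite -powRrM mulVf ?(lt0r_neq0 q20) // powRr1 //.
  by rewrite divr_ge0 ?(ltW c0) ?(ltW KL).
have sE : s `^ (q - 2) < c / (K + L).
  by rewrite -eE; apply: gt0_ltr_powR => //; rewrite nnegrE ltW.
rewrite mulrA mulrDl divfK ?expf_neq0 ?lt0r_neq0 //.
apply: (@le_lt_trans _ _ ((K + L) * s `^ (q - 2))).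
  rewrite ler_wpM2r ?powR_ge0 // lerD2l ler_piMr ?ltW //.
  by rewrite expr_lt1 // ltW.
by rewrite mulrC -ltr_pdivlMr.
Qed.

Theorem theorem3p3 (R : realType) (N : nat) (N_gt1 : (1 < N)%N)
  (Omega : set 'rV[R]_N)
  (Omega_open : open Omega) (Omega_bounded : bounded_set Omega)
  (Omega_C1 : C1_boundary Omega)
  (delta : R) (delta_gt0 : 0 < delta)
  (bdist_C1 : C1_on (strip Omega delta) (bdist Omega))
  (A : 'rV[R]_N -> 'M[R]_N)
  (A_psd : forall x, Omega x -> psdmx (A x) /\ A x != 0)
  (A_lipschitz : [lipschitz A x | x in Omega])
  (lambda Lambda : R) (lambda_gt0 : 0 < lambda) (le_lambda : lambda <= Lambda)
  (A_bounds : forall x xi : 'rV[R]_N, Omega x -> enorm xi = 1 ->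
     0 <= \tr (A x *m tensor xi xi) <= Lambda)
  (A_normal : forall x : 'rV[R]_N, strip Omega delta x ->
     let n := - grad (bdist Omega) x in lambda <= \tr (A x *m tensor n n))
  (m q : R) (m_gt1 : 1 < m) (q_ge : 2 * m / (m - 1) <= q)
  (f : 'rV[R]_N -> R) (l : \bar R) (l_gt0 : (0 < l)%E)
  (f_liminf :
     limf_einf (fun x => (f x * bdist Omega x `^ q)%:E) (near_boundary Omega)
     = l)
  (v : 'rV[R]_N -> R) (v_ge0 : forall x, Omega x -> 0 <= v x)
  (v_super : supersolution Omega A m f v) :
  large_supersolution Omega A m f v.
Proof.
split=> //; apply/cvgeyPge => M0.
have q_gt2 := exponent_gt2 m_gt1 q_ge.
have Lambda_ge0 : 0 <= Lambda by apply/ltW/(lt_le_trans lambda_gt0).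
have m_ge0 : 0 <= m by apply: ltW (lt_trans _ m_gt1).
pose T := N%:R * Lambda.
have T_ge0 : 0 <= T by rewrite mulr_ge0.
have trA y : Omega y -> \tr (A y) <= T.
  by move=> Oy; apply: mxtrace_le => xi /(A_bounds _ _ Oy)/andP[].
pose M := Num.max M0 1.
have M_gt0 : 0 < M by rewrite lt_max ltr01 orbT.
move: l_gt0; rewrite -f_liminf => /limf_einf_near_boundary_gt0[c [e [c0 e0 ef]]].
(* With [s] equal to twice the distance [d] of [x] to the boundary and the ball
   of radius [d / 2], the constant [M / r ^ 2] is [16 M / s ^ 2]. *)
have [e1 e1_gt0 small] := powR_absorb q_gt2 c0
  (mulr_ge0 (mulr_ge0 (ler0n _ 32) (ltW M_gt0)) T_ge0) (powR_gt0 m M_gt0).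
exists (Num.min e e1 / 2) => /=; first by rewrite divr_gt0 // lt_min e0 e1_gt0.
move=> x [Ox]; rewrite ltr_pdivlMr // lt_min => /andP[xe xe1].
rewrite (lsc_envK v_ge0 Ox) lee_fin; apply: (@le_trans _ _ M).
  by rewrite le_max lexx.
rewrite leNgt; apply/negP => uxM; set d := bdist Omega x in xe xe1.
(* At a point with [d = 0] the bound [c <= f d^q] would read [c <= 0]. *)
have d0 : 0 < d.
  rewrite lt_def bdist_ge0 andbT; apply/eqP => d0.
  have : c <= f x * bdist Omega x `^ q.
    by apply: ef; split=> //; rewrite -/d d0; lra.
  by rewrite -/d d0 powR0 ?mulr0 ?leNgt ?c0 //; apply: lt0r_neq0; lra.
have r0 : 0 < d / 2 by rewrite divr_gt0.
have rO y : enorm (y - x) <= d / 2 -> Omega y.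
  by move=> yx; apply: (eball_subset Ox); rewrite -/d; lra.
have [y yx fy] := supersolution_eball m_ge0 v_ge0 v_super trA r0 rO uxM.
have dy : bdist Omega y <= d * 2.
  by have := bdist_lipschitz x y (boundary_neq0 d0); rewrite -/d; lra.
have cy : c <= f y * bdist Omega y `^ q.
  apply: ef; split; first exact: rO.
  by have := bdist_lipschitz x y (boundary_neq0 d0); rewrite -/d; lra.
have dyq : bdist Omega y `^ q <= (d * 2) `^ q.
  by apply: ge0_ler_powR; rewrite ?nnegrE ?bdist_ge0 //; lra.
have s0 : 0 < d * 2 by lra.
have sE : 2 * (M / (d / 2) ^+ 2) * T = 32 * M * T / (d * 2) ^+ 2.
  by field; exact: lt0r_neq0.
have fy0 : 0 <= f y.
  rewrite leNgt; apply/negP => fy0; move: cy; rewrite leNgt => /negP; apply.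
  by apply: le_lt_trans c0; rewrite mulr_le0_ge0 ?powR_ge0 // ltW.
move: (small _ s0 xe1); rewrite ltNge => /negP; apply; apply: (le_trans cy).
by rewrite -sE; apply: ler_pM; rewrite ?powR_ge0.
Qed.
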